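(* For every $p\ge0$ and every $n\ge2$, there exists a $\Sigma^0_p$ equivalence relation on $\omega$ which is complete under $n$-ary reducibility $\leq_c^n$ among $\Sigma^0_p$ equivalence relations, but fails to be complete among them under $\leq_c^{n+1}$. Likewise, there exists a $\Pi^0_p$ equivalence relation on $\omega$ which is complete under $\leq_c^n$ among $\Pi^0_p$ equivalence relations, but not under $\leq_c^{n+1}$.
   Context: For equivalence relations $E,F$ on $\omega$ and $n\ge1$, $F\leq_c^nE$ means there is a total computable function mapping each $(x_0,\dots,x_{n-1})\in\omega^n$ to $(y_0,\dots,y_{n-1})\in\omega^n$ with $x_i\,F\,x_j\iff y_i\,E\,y_j$ for all $i<j<n$. A $\Sigma^0_p$ (resp. $\Pi^0_p$) equivalence relation is an equivalence relation on $\omega$ that is a $\Sigma^0_p$ (resp. $\Pi^0_p$) subset of $\omega\times\omega$; $\Sigma^0_0=\Pi^0_0$ means computable. $E$ is complete under $\leq_c^n$ among a class if it belongs to the class and every member $F$ of the class satisfies $F\leq_c^nE$. *)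

(* Defs.v *)
From mathcomp Require Import all_boot.
Unset Printing Implicit Defensive.

Inductive code : Type :=
| Zero : code
| Succ : code
| Proj : nat -> code
| Comp : code -> list code -> code
| Prim : code -> code -> code
| Mu   : code -> code.

Inductive eval : code -> seq nat -> nat -> Prop :=
| evZero a : eval Zero a 0
| evSucc a : eval Succ a (nth 0 a 0).+1
| evProj i a : eval (Proj i) a (nth 0 a i)
| evComp f gs a ys y : evals gs a ys -> eval f ys y -> eval (Comp f gs) a y
| evPrim0 f g a y : eval f a y -> eval (Prim f g) (0 :: a) y
| evPrimS f g k a z y : eval (Prim f g) (k :: a) z ->
    eval g (k :: z :: a) y -> eval (Prim f g) (k.+1 :: a) y
| evMu f a y : eval f (y :: a) 0 ->
    (forall k, k < y -> exists m, eval f (k :: a) m.+1) -> eval (Mu f) a y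
with evals : seq code -> seq nat -> seq nat -> Prop :=
| evsNil a : evals [::] a [::]
| evsCons g gs a y ys : eval g a y -> evals gs a ys -> evals (g :: gs) a (y :: ys).

Definition computable_pred (k : nat) (P : seq nat -> Prop) : Prop :=
  exists c, forall l, size l = k -> exists y, eval c l y /\ (P l <-> y = 0).

Fixpoint Sigma0 (p : nat) (k : nat) (P : seq nat -> Prop) {struct p} : Prop :=
  match p with
  | 0 => computable_pred k P
  | p'.+1 => exists Q, Pi0 p' k.+1 Q /\
      forall l, size l = k -> (P l <-> exists x, Q (x :: l))
  end
with Pi0 (p : nat) (k : nat) (P : seq nat -> Prop) {struct p} : Prop :=
  match p with
  | 0 => computable_pred k P
  | p'.+1 => exists Q, Sigma0 p' k.+1 Q /\
      forall l, size l = k -> (P l <-> forall x, Q (x :: l))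
  end.

Definition rel_pred (R : nat -> nat -> Prop) : seq nat -> Prop :=
  fun l => R (nth 0 l 0) (nth 0 l 1).

Definition Sigma0_rel (p : nat) (R : nat -> nat -> Prop) := Sigma0 p 2 (rel_pred R).
Definition Pi0_rel (p : nat) (R : nat -> nat -> Prop) := Pi0 p 2 (rel_pred R).

Definition eqrel_omega (R : nat -> nat -> Prop) : Prop :=
  (forall x, R x x) /\ (forall x y, R x y -> R y x) /\
  (forall x y z, R x y -> R y z -> R x z).

Definition computable_tuple_map (n : nat) (G : n.-tuple nat -> n.-tuple nat) : Prop :=
  forall i : 'I_n, exists c, forall x : n.-tuple nat, eval c (tval x) (tnth (G x) i).

Definition nary_reducible (n : nat) (F E : nat -> nat -> Prop) : Prop :=
  exists G : n.-tuple nat -> n.-tuple nat, @computable_tuple_map n G /\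
    forall (x : n.-tuple nat) (i j : 'I_n), i < j ->
      (F (tnth x i) (tnth x j) <-> E (tnth (G x) i) (tnth (G x) j)).

(* Main.v *)
(** For [p = 0] the relation with exactly [n] computable classes works, since
    equality does not (n+1)-reduce to it. For [p > 0], let [E] consist of one block
    of [n] elements for every pair (e, x) of an index and an n-tuple, related inside
    the block as the entries of x are by the equivalence closure of the e-th
    relation of the class; [E] is n-complete by construction. A reduction of n+1
    elements into [E] always reveals one fact: either two images coincide, or the
    images are pairwise distinct and hence, blocks having size [n], not all
    equivalent. A relation that collapses its e-th block exactly when the e-th
    predicate holds of n+1 chosen elements of this block diagonalises against
    that information. Only closure under finite conjunctions, disjunctions and
    computable substitutions and the existence of universal predicates are used,
    so Sigma and Pi classes are handled together. *)
Require Import Defs.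
From mathcomp Require Import all_boot.
From mathcomp Require Import zify.
From Stdlib Require Import Classical ClassicalEpsilon.

(** * Closure properties of total computable functions *)

Definition computable_fun (k : nat) (f : seq nat -> nat) : Prop :=
  exists c, forall l, size l = k -> eval c l (f l).

Lemma computable_fun_ext k f g :
  (forall l, size l = k -> f l = g l) -> computable_fun k f -> computable_fun k g.
Proof. by move=> fg [c hc]; exists c => l sl; rewrite -fg //; apply: hc. Qed.

Lemma computable_fun_codes {I : eqType} k (s : seq I) (gs : I -> seq nat -> nat) :
  (forall i, i \in s -> computable_fun k (gs i)) ->
  exists cs, forall l, size l = k -> evals cs l [seq gs i l | i <- s].
Proof.
elim: s => [|i s IHs] hgs; first by exists [::] => l _; constructor.
have [|cs hcs] := IHs; first by move=> j js; apply: hgs; rewrite inE js orbT.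
have [c hc] := hgs i (mem_head i s).
by exists (c :: cs) => l sl; constructor; [exact: hc | exact: hcs].
Qed.

Lemma computable_fun_subst {k m f} {gs : nat -> seq nat -> nat} :
  computable_fun k f -> (forall i, i < k -> computable_fun m (gs i)) ->
  computable_fun m (fun l => f (mkseq (gs^~ l) k)).
Proof.
move=> [c hc] hgs; have [|cs hcs] := @computable_fun_codes _ m (iota 0 k) gs.
  by move=> i; rewrite mem_iota => /hgs.
by exists (Comp c cs) => l sl; apply: evComp (hcs l sl) (hc _ _); rewrite size_mkseq.
Qed.

Lemma computable_nth k i : computable_fun k (fun l => nth 0 l i).
Proof. by exists (Proj i) => l _; constructor. Qed.

Lemma computable_const k n : computable_fun k (fun=> n).
Proof.
elim: n => [|n [c hc]]; first by exists Zero => l _; constructor.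
exists (Comp Succ [:: c]) => l sl; apply: evComp (evSucc [:: n]).
by constructor; [exact: hc | constructor].
Qed.

Lemma computable_app1 h k f :
  computable_fun 1 (fun l => h (nth 0 l 0)) -> computable_fun k f ->
  computable_fun k (fun l => h (f l)).
Proof. by move=> hh hf; apply: (computable_fun_subst (gs := fun=> f) hh). Qed.

Lemma computable_app2 h k f g :
  computable_fun 2 (fun l => h (nth 0 l 0) (nth 0 l 1)) ->
  computable_fun k f -> computable_fun k g ->
  computable_fun k (fun l => h (f l) (g l)).
Proof.
move=> hh hf hg.
by apply: (computable_fun_subst (gs := fun i => if i is 0 then f else g) hh) => -[].
Qed.

Lemma computable_behead k f :
  computable_fun k f -> computable_fun k.+1 (fun l => f (behead l)).
Proof.
move=> hf; apply: computable_fun_ext (computable_fun_subst hf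
  (fun i _ => computable_nth k.+1 i.+1)) => -[|x l] //= [sl].
by congr f; rewrite -[in RHS](mkseq_nth 0 l) sl.
Qed.

Lemma computable_rec k b g f :
  computable_fun k b -> computable_fun k.+2 g -> computable_fun k f ->
  computable_fun k
    (fun l => nat_rec (fun=> nat) (b l) (fun i z => g (i :: z :: l)) (f l)).
Proof.
move=> [cb hb] [cg hg] [cf hf].
have [cs hcs] := @computable_fun_codes _ k (iota 0 k) (fun i l => nth 0 l i)
  (fun i _ => computable_nth k i).
(* [Prim] recurses on the head of its argument list, so [f l] is computed first and placed before a
   copy of the parameters. *)
exists (Comp (Prim cb cg) (cf :: cs)) => l sl.
apply: (@evComp _ _ _ (f l :: l)); first constructor; first exact: hf.
  by rewrite -[X in evals _ _ X](mkseq_nth 0 l) sl; exact: hcs.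
elim: (f l) => [|i IH] /=; first by apply/evPrim0/hb.
by apply: evPrimS IH _; apply: hg; rewrite /= sl.
Qed.

Lemma computable_succ k f :
  computable_fun k f -> computable_fun k (fun l => (f l).+1).
Proof. by apply: (@computable_app1 succn); exists Succ => l _; constructor. Qed.

Lemma computable_pred_fun k f :
  computable_fun k f -> computable_fun k (fun l => (f l).-1).
Proof.
move=> hf; apply: computable_fun_ext (computable_rec _ _ _ _
  (computable_const k 0) (computable_nth k.+2 0) hf) => l _.
by case: (f l).
Qed.

Lemma computable_add k f g :
  computable_fun k f -> computable_fun k g -> computable_fun k (fun l => f l + g l).
Proof.
move=> hf hg; apply: computable_fun_ext (computable_rec _ _ _ _ hg
  (computable_succ _ _ (computable_nth k.+2 1)) hf) => l _ /=.
by elim: (f l) => //= n ->.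
Qed.

Lemma computable_sub k f g :
  computable_fun k f -> computable_fun k g -> computable_fun k (fun l => f l - g l).
Proof.
move=> hf hg; apply: computable_fun_ext (computable_rec _ _ _ _ hf
  (computable_pred_fun _ _ (computable_nth k.+2 1)) hg) => l _ /=.
by elim: (g l) => [|n /= ->]; rewrite ?subn0 ?subnS.
Qed.

Lemma computable_mul k f g :
  computable_fun k f -> computable_fun k g -> computable_fun k (fun l => f l * g l).
Proof.
move=> hf hg; apply: computable_fun_ext (computable_rec _ _ _ _
  (computable_const k 0) (computable_add _ _ _ (computable_nth k.+2 1)
  (computable_behead _ _ (computable_behead _ _ hg))) hf) => l _ /=.
by elim: (f l) => [|n /= ->] //; rewrite mulSn addnC.
Qed.

Definition ifz (a b c : nat) : nat := if a is 0 then b else c.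

Lemma computable_ifz k f g h :
  computable_fun k f -> computable_fun k g -> computable_fun k h ->
  computable_fun k (fun l => ifz (f l) (g l) (h l)).
Proof.
move=> hf hg hh; apply: computable_fun_ext (computable_rec _ _ _ _ hg
  (computable_behead _ _ (computable_behead _ _ hh)) hf) => l _ /=.
by case: (f l).
Qed.

Lemma computable_iter k h f g :
  computable_fun 1 (fun l => h (nth 0 l 0)) ->
  computable_fun k f -> computable_fun k g ->
  computable_fun k (fun l => iter (f l) h (g l)).
Proof.
move=> hh hf hg; apply: computable_fun_ext (computable_rec _ _ _ _ hg
  (computable_app1 _ _ _ hh (computable_nth k.+2 1)) hf) => l _ /=.
by elim: (f l) => //= n ->.
Qed.

(** * Integer square root, pairing, and numerical codes of sequences and programs *)

Fixpoint isqrt (z : nat) : nat :=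
  if z is z'.+1 then
    ifz ((isqrt z').+1 * (isqrt z').+1 - z) (isqrt z').+1 (isqrt z')
  else 0.

Lemma isqrt_bounds z : isqrt z * isqrt z <= z < (isqrt z).+1 * (isqrt z).+1.
Proof.
elim: z => //= z; move: (isqrt z) => r IH.
by case E: (r.+1 * r.+1 - z.+1) => [|d] /=; nia.
Qed.

(* Locked: otherwise unification computes the unary value of closed codes. *)
Fact npair_key : unit. Proof. exact: tt. Qed.
Definition npair (x y : nat) : nat := locked_with npair_key ((x + y) * (x + y) + x).

Lemma npairE x y : npair x y = (x + y) * (x + y) + x.
Proof. exact: unlock. Qed.

Definition nfst (z : nat) : nat := z - isqrt z * isqrt z.
Definition nsnd (z : nat) : nat := isqrt z - nfst z.

(** The code lies between the square of [x + y] and the next square. *)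
Lemma isqrt_npair x y : isqrt (npair x y) = x + y.
Proof.
have := isqrt_bounds (npair x y); move: (isqrt _) => r; rewrite npairE => hr.
case: (ltngtP r (x + y)) => // h.
  by have := leq_mul h h; lia.
by have := leq_mul h h; lia.
Qed.

Lemma nfst_npair x y : nfst (npair x y) = x.
Proof. by rewrite /nfst isqrt_npair npairE addKn. Qed.

Lemma nsnd_npair x y : nsnd (npair x y) = y.
Proof. by rewrite /nsnd nfst_npair isqrt_npair addKn. Qed.

Lemma npair_inj x y x' y' : npair x y = npair x' y' -> x = x' /\ y = y'.
Proof.
move=> e; split; first by rewrite -(nfst_npair x y) e nfst_npair.
by rewrite -(nsnd_npair x y) e nsnd_npair.
Qed.

Lemma computable_npair k f g :
  computable_fun k f -> computable_fun k g ->
  computable_fun k (fun l => npair (f l) (g l)).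
Proof.
move=> hf hg; apply: (@computable_fun_ext _ (fun l => (f l + g l) * (f l + g l) + f l)).
  by move=> l _; rewrite npairE.
by do ?[apply: computable_add | apply: computable_mul].
Qed.

Lemma computable_isqrt k f :
  computable_fun k f -> computable_fun k (fun l => isqrt (f l)).
Proof.
pose r := (fun l : seq nat => (nth 0 l 1).+1).
have hr : computable_fun k.+2 r by apply/computable_succ/computable_nth.
move=> hf; apply: computable_fun_ext (computable_rec _ _ _ _
  (computable_const k 0) (computable_ifz _ _ _ _ (computable_sub _ _ _
   (computable_mul _ _ _ hr hr) (computable_succ _ _ (computable_nth k.+2 0)))
   hr (computable_nth k.+2 1)) hf) => l _ /=.
by elim: (f l) => //= n ->.
Qed.

Lemma computable_nfst k f :
  computable_fun k f -> computable_fun k (fun l => nfst (f l)).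
Proof.
move=> hf; apply: computable_sub => //.
by apply: computable_mul; apply: computable_isqrt.
Qed.

Lemma computable_nsnd k f :
  computable_fun k f -> computable_fun k (fun l => nsnd (f l)).
Proof.
by move=> hf; apply: computable_sub; [apply: computable_isqrt | apply: computable_nfst].
Qed.


(* No injectivity: [::] and [:: 0] are both coded by 0, which is harmless
   because evaluation reads its arguments with default value 0. *)
Definition enc_seq (l : seq nat) : nat := foldr npair 0 l.

Definition enc_nth (a i : nat) : nat := nfst (iter i nsnd a).

Lemma enc_nthE l i : enc_nth (enc_seq l) i = nth 0 l i.
Proof.
elim: i l => [|i IH] [|x l]; rewrite /enc_nth ?iterSr /= ?nfst_npair ?nsnd_npair //.
  by have := IH [::]; rewrite nth_nil.
exact: IH.
Qed.

Lemma computable_enc_nth k f g :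
  computable_fun k f -> computable_fun k g ->
  computable_fun k (fun l => enc_nth (f l) (g l)).
Proof.
move=> hf hg; apply/computable_nfst/computable_iter => //.
exact/computable_nsnd/computable_nth.
Qed.

Lemma computable_enc_seq {I : eqType} k (s : seq I) (gs : I -> seq nat -> nat) :
  (forall i, i \in s -> computable_fun k (gs i)) ->
  computable_fun k (fun l => enc_seq [seq gs i l | i <- s]).
Proof.
elim: s => [|i s IHs] hgs; first exact: computable_const.
apply: computable_npair; first exact/hgs/mem_head.
by apply: IHs => j js; apply: hgs; rewrite inE js orbT.
Qed.

(* Lists of codes are encoded as additional codes (tags 6 and 7), whose value
   is the encoded list of values. *)
Fixpoint enc (c : code) : nat :=
  match c with
  | Zero => npair 0 0
  | Succ => npair 1 0
  | Proj i => npair 2 i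
  | Comp f gs =>
      npair 3 (npair (enc f)
        (foldr (fun g r => npair 7 (npair g r)) (npair 6 0) (map enc gs)))
  | Prim f g => npair 4 (npair (enc f) (enc g))
  | Mu f => npair 5 (enc f)
  end.

(** * A stack machine running encoded programs *)

Definition enc_codes (gs : seq code) : nat :=
  foldr (fun g r => npair 7 (npair g r)) (npair 6 0) (map enc gs).

(** Tag 0 marks a state evaluating code [c] on argument [a]; tag 1, in [ret], marks the return of a
    value to the stack [K]. The number 0 is the empty stack. *)
Definition ev (c a K : nat) : nat := npair 0 (npair c (npair a K)).
Definition ret (v K : nat) : nat := npair 1 (npair v K).
Definition push (t d K : nat) : nat := npair (npair t d) K.

(** The nested [ifz] on predecessors of [t] is a case distinction on the tag of the code, from
    [Zero] up to the two list tags. *)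
Definition step_ev (c a K : nat) : nat :=
  let t := nfst c in let d := nsnd c in
  ifz t (ret 0 K) (ifz t.-1 (ret (nfst a).+1 K) (ifz t.-2 (ret (enc_nth a d) K)
  (ifz t.-2.-1 (ev (nsnd d) a (push 1 (nfst d) K))
  (ifz t.-2.-2 (ifz (nfst a) (ev (nfst d) (nsnd a) K)
     (ev c (npair (nfst a).-1 (nsnd a)) (push 2 (npair (nsnd d) a) K)))
  (ifz t.-2.-2.-1 (ev d (npair 0 a) (push 3 (npair d (npair 0 a)) K))
  (ifz t.-2.-2.-2 (ret 0 K)
     (ev (nfst d) a (push 4 (npair (nsnd d) a) K)))))))).

(** Frame 0 halts; an empty stack reads as such a frame. Frame 1 applies the outer function of a
    composition, 2 makes a recursion step, 3 tests a search candidate, 4 goes on to the rest of a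
    list, 5 rebuilds the list. *)
Definition step_ret (s v t d K : nat) : nat :=
  ifz t s (ifz t.-1 (ev d v K)
  (ifz t.-2 (ev (nfst d)
     (npair (nfst (nsnd d)).-1 (npair v (nsnd (nsnd d)))) K)
  (ifz t.-2.-1 (ifz v (ret (nfst (nsnd d)) K)
     (ev (nfst d) (npair (nfst (nsnd d)).+1 (nsnd (nsnd d)))
        (push 3 (npair (nfst d)
           (npair (nfst (nsnd d)).+1 (nsnd (nsnd d)))) K)))
  (ifz t.-2.-2 (ev (nfst d) (nsnd d) (push 5 v K))
     (ret (npair d v) K))))).

Definition step (s : nat) : nat :=
  ifz (nfst s) (step_ev (nfst (nsnd s)) (nfst (nsnd (nsnd s))) (nsnd (nsnd (nsnd s))))
    (step_ret s (nfst (nsnd s)) (nfst (nfst (nsnd (nsnd s))))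
       (nsnd (nfst (nsnd (nsnd s)))) (nsnd (nsnd (nsnd s)))).

Ltac computability := repeat first
  [ apply: computable_ifz | apply: computable_npair | apply: computable_enc_nth
  | apply: computable_nfst | apply: computable_nsnd | apply: computable_succ
  | apply: computable_pred_fun | apply: computable_nth | apply: computable_const ].

Lemma computable_step k f :
  computable_fun k f -> computable_fun k (fun l => step (f l)).
Proof.
apply: computable_app1; rewrite /step /step_ev /step_ret /ev /ret /push.
by computability.
Qed.

Lemma step_evE c a K : step (ev c a K) = step_ev c a K.
Proof. by rewrite /step /ev !(nfst_npair, nsnd_npair). Qed.

Lemma step_retE v t d K :
  step (ret v (push t d K)) = step_ret (ret v (push t d K)) v t d K.
Proof. by rewrite {1}/step {1 2 3 4 5 6}/ret /push !(nfst_npair, nsnd_npair). Qed.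


(** * Simulation of evaluation by the machine *)

Definition reaches (s t : nat) : Prop := exists m, iter m step s = t.

Lemma reaches_refl s : reaches s s.
Proof. by exists 0. Qed.

Lemma reaches_step s s' t : step s = s' -> reaches s' t -> reaches s t.
Proof. by move=> <- [m <-]; exists m.+1; rewrite iterSr. Qed.

Lemma reaches_trans s t u : reaches s t -> reaches t u -> reaches s u.
Proof. by move=> [m <-] [m' <-]; exists (m' + m); rewrite iterD. Qed.

Ltac machine_step := apply: reaches_step;
  [ rewrite ?step_evE ?step_retE /step_ev /step_ret ?(nfst_npair, nsnd_npair) /=
      ?(nfst_npair, nsnd_npair) /=; reflexivity |].

(* The fixpoint is needed because [evMu] nests [eval] under an existential. *)
Fixpoint eval_reaches {c a y} (h : eval c a y) {struct h} :
  forall K, reaches (ev (enc c) (enc_seq a) K) (ret y K)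
with evals_reaches {gs a ys} (h : evals gs a ys) {struct h} :
  forall K, reaches (ev (enc_codes gs) (enc_seq a) K) (ret (enc_seq ys) K).
Proof.
- case: h => {c a y}.
  + move=> a K; machine_step; exact: reaches_refl.
  + move=> a K; machine_step; rewrite -[nfst _]/(enc_nth _ 0) enc_nthE.
    exact: reaches_refl.
  + move=> i a K; machine_step; rewrite enc_nthE; exact: reaches_refl.
  + move=> f gs a ys y hgs hf K /=; rewrite -/(enc_codes gs); machine_step.
    apply: reaches_trans (evals_reaches _ _ _ hgs _) _; machine_step.
    exact: eval_reaches hf K.
  + move=> f g a y hf K; machine_step; exact: eval_reaches hf K.
  + move=> f g k a z y hk hg K; machine_step.
    apply: reaches_trans (eval_reaches _ _ _ hk _) _; machine_step.
    exact: eval_reaches hg K.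
  + move=> f a y hy hlt K; machine_step.
    (* Candidates below [y] return nonzero values, so the search passes from 0 up to [y]. *)
    have hmu : forall k, k <= y -> reaches
        (ev (enc f) (npair 0 (enc_seq a)) (push 3 (npair (enc f) (npair 0 (enc_seq a))) K))
        (ev (enc f) (npair k (enc_seq a)) (push 3 (npair (enc f) (npair k (enc_seq a))) K)).
      elim=> [|k IH] hk; first exact: reaches_refl.
      apply: reaches_trans (IH (ltnW hk)) _.
      case: (hlt k hk) => m hm.
      apply: reaches_trans (eval_reaches _ _ _ hm _) _; machine_step.
      exact: reaches_refl.
    apply: reaches_trans (hmu y (leqnn y)) _.
    apply: reaches_trans (eval_reaches _ _ _ hy _) _; machine_step.
    exact: reaches_refl.
- case: h => {gs a ys}.
  + move=> a K; rewrite /enc_codes /=; machine_step; exact: reaches_refl.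
  + move=> g gs a y ys hg hgs K /=.
    rewrite -[enc_codes (g :: gs)]/(npair 7 (npair (enc g) (enc_codes gs))).
    machine_step; apply: reaches_trans (eval_reaches _ _ _ hg _) _; machine_step.
    apply: reaches_trans (evals_reaches _ _ _ hgs _) _; machine_step.
    exact: reaches_refl.
Qed.

Lemma ret_halted m v : iter m step (ret v 0) = ret v 0.
Proof. by elim: m => //= m ->; rewrite /step /ret !(nfst_npair, nsnd_npair). Qed.

Lemma ret_inj v w K : ret v K = ret w K -> v = w.
Proof. by move=> /npair_inj[_ /npair_inj[]]. Qed.

(** Halted states are fixed by [step], so two runs can be extended to a common length. This replaces
    a converse simulation: for a code known to converge, the output of the machine is its value. *)
Lemma reaches_ret_unique s v w : reaches s (ret v 0) -> reaches s (ret w 0) -> v = w.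
Proof.
move=> [m hm] [m' hm']; apply: (@ret_inj _ _ 0).
by rewrite -(ret_halted m' v) -hm -iterD addnC iterD hm' ret_halted.
Qed.

(** * Computable predicates *)

Lemma computable_predP k P :
  computable_pred k P <->
  exists f, computable_fun k f /\ forall l, size l = k -> (P l <-> f l = 0).
Proof.
split=> [[c hc]|[f [[c hc] hf]]]; last first.
  by exists c => l sl; exists (f l); split; [exact: hc | exact: hf].
(* The code yields outputs only existentially; choice turns them into a function. *)
pose f l := epsilon (inhabits 0) (fun y => eval c l y /\ (P l <-> y = 0)).
have hf l : size l = k -> eval c l (f l) /\ (P l <-> f l = 0).
  by move=> sl; exact: (epsilon_spec (inhabits 0) _ (hc l sl)).
by exists f; split; [exists c|] => l /hf[].
Qed.

Lemma computable_pred_eq k f g :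
  computable_fun k f -> computable_fun k g ->
  computable_pred k (fun l => f l = g l).
Proof.
move=> hf hg; apply/computable_predP.
exists (fun l => (f l - g l) + (g l - f l)); split; last by move=> l _; lia.
by apply: computable_add; apply: computable_sub.
Qed.

Lemma computable_pred_const k (b : bool) : computable_pred k (fun=> b).
Proof.
apply/computable_predP; exists (fun=> ~~ b : nat); split; first exact: computable_const.
by case: b.
Qed.

Lemma computable_pred_not k P :
  computable_pred k P -> computable_pred k (fun l => ~ P l).
Proof.
move=> /computable_predP[f [hf Pf]]; apply/computable_predP.
exists (fun l => ifz (f l) 1 0); split; first by computability.
by move=> l sl; rewrite Pf //; case: (f l).
Qed.

Lemma computable_pred_and k P Q :
  computable_pred k P -> computable_pred k Q ->
  computable_pred k (fun l => P l /\ Q l).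
Proof.
move=> /computable_predP[f [hf Pf]] /computable_predP[g [hg Qg]].
apply/computable_predP; exists (fun l => f l + g l); split.
  exact: computable_add.
by move=> l sl; rewrite Pf // Qg //; lia.
Qed.

Lemma computable_pred_or k P Q :
  computable_pred k P -> computable_pred k Q ->
  computable_pred k (fun l => P l \/ Q l).
Proof.
move=> /computable_predP[f [hf Pf]] /computable_predP[g [hg Qg]].
apply/computable_predP; exists (fun l => f l * g l); split.
  exact: computable_mul.
by move=> l sl; rewrite Pf // Qg //; nia.
Qed.

Lemma computable_pred_subst {k m P} {gs : nat -> seq nat -> nat} :
  (forall i, i < k -> computable_fun m (gs i)) -> computable_pred k P ->
  computable_pred m (fun l => P (mkseq (gs^~ l) k)).
Proof.
move=> hgs /computable_predP[f [hf Pf]]; apply/computable_predP.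
exists (fun l => f (mkseq (gs^~ l) k)); split; first exact: computable_fun_subst.
by move=> l _; apply: Pf; rewrite size_mkseq.
Qed.

Lemma computable_pred_ext k P Q :
  (forall l, size l = k -> (P l <-> Q l)) -> computable_pred k P -> computable_pred k Q.
Proof.
move=> PQ [c hc]; exists c => l sl; have [y [? ?]] := hc l sl.
by exists y; rewrite -PQ.
Qed.

(** * Closure properties of the arithmetical hierarchy *)

Lemma Sigma0_ext p k P Q :
  (forall l, size l = k -> (P l <-> Q l)) -> Sigma0 p k P -> Sigma0 p k Q.
Proof.
case: p => [|p] PQ; first exact: computable_pred_ext.
by move=> [S [hS PS]]; exists S; split=> // l sl; rewrite -PQ ?PS.
Qed.

Lemma Pi0_ext p k P Q :
  (forall l, size l = k -> (P l <-> Q l)) -> Pi0 p k P -> Pi0 p k Q.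
Proof.
case: p => [|p] PQ; first exact: computable_pred_ext.
by move=> [S [hS PS]]; exists S; split=> // l sl; rewrite -PQ ?PS.
Qed.

Lemma hierarchy_not p : forall k P,
  (Sigma0 p k P -> Pi0 p k (fun l => ~ P l)) /\
  (Pi0 p k P -> Sigma0 p k (fun l => ~ P l)).
Proof.
elim: p => [|p IH] k P; first by split; apply: computable_pred_not.
split=> -[Q [hQ PQ]]; exists (fun l => ~ Q l); split.
- exact: (IH _ Q).2.
- by move=> l sl; rewrite PQ //; split=> [h x Qx|h [x]]; [apply: h; exists x | exact: h].
- exact: (IH _ Q).1.
- move=> l sl; rewrite PQ //; split=> [|[x Qx] h]; last exact: Qx (h x).
  exact: not_all_ex_not.
Qed.

Lemma Pi0P p k P : Pi0 p k P <-> Sigma0 p k (fun l => ~ P l).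
Proof.
split=> [|/(hierarchy_not p k _).1]; first exact: (hierarchy_not p k P).2.
by apply: Pi0_ext => l _; split=> [/NNPP|? ?].
Qed.

Lemma hierarchy_computable p : forall k P, computable_pred k P ->
  Sigma0 p k P /\ Pi0 p k P.
Proof.
elim: p => [|p IH] k P hP //.
(* A dummy first argument is added, to be bound by a vacuous quantifier. *)
have hP' : computable_pred k.+1 (fun l => P (behead l)).
  apply: computable_pred_ext (computable_pred_subst
    (fun i _ => computable_nth k.+1 i.+1) hP) => -[|x l] //= [sl].
  by rewrite -[X in _ <-> P X](mkseq_nth 0 l) sl.
have [hS hP1] := IH _ _ hP'.
split; exists (fun l => P (behead l)); split=> // l _ /=.
  by split=> [?|[]//]; exists 0.
by split=> [//|/(_ 0)].
Qed.

Lemma hierarchy_subst p : forall k m P (gs : nat -> seq nat -> nat),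
  (forall i, i < k -> computable_fun m (gs i)) ->
  (Sigma0 p k P -> Sigma0 p m (fun l => P (mkseq (gs^~ l) k))) /\
  (Pi0 p k P -> Pi0 p m (fun l => P (mkseq (gs^~ l) k))).
Proof.
elim: p => [|p IH] k m P gs hgs; first by split; apply: computable_pred_subst.
(* The quantified variable stays in front; the given substitution acts on the other arguments. *)
pose gs' i := if i is j.+1 then fun l => gs j (behead l) else fun l => nth 0 l 0.
have hgs' i : i < k.+1 -> computable_fun m.+1 (gs' i).
  by case: i => [|i] hi; [exact: computable_nth | apply/computable_behead/hgs].
have gs'E x l : mkseq (gs'^~ (x :: l)) k.+1 = x :: mkseq (gs^~ l) k.
  by rewrite /mkseq /= -[1]/(1 + 0) iotaDl -map_comp.
split=> -[Q [hQ PQ]]; exists (fun l => Q (mkseq (gs'^~ l) k.+1)).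
- split; first exact: (IH _ _ Q _ hgs').2.
  move=> l sl; rewrite PQ ?size_mkseq //.
  by split=> -[x]; exists x; rewrite ?gs'E // -gs'E.
- split; first exact: (IH _ _ Q _ hgs').1.
  move=> l sl; rewrite PQ ?size_mkseq //.
  by split=> h x; have := h x; rewrite gs'E.
Qed.

(** Existential quantifiers merge directly over a disjunction; over a conjunction the two witnesses
    are packed into a pair. *)
Lemma Sigma0_and_or p : forall k P Q, Sigma0 p k P -> Sigma0 p k Q ->
  Sigma0 p k (fun l => P l /\ Q l) /\ Sigma0 p k (fun l => P l \/ Q l).
Proof.
elim: p => [|p IH] k P Q.
  by split; [exact: computable_pred_and | exact: computable_pred_or].
have Pi0_and_or k' A B : Pi0 p k' A -> Pi0 p k' B ->
    Pi0 p k' (fun l => A l /\ B l) /\ Pi0 p k' (fun l => A l \/ B l).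
  move=> /Pi0P hA /Pi0P hB; have [hI hU] := IH _ _ _ hA hB.
  split; apply/Pi0P; [apply: Sigma0_ext hU|apply: Sigma0_ext hI] => l _; tauto.
move=> [A [hA PA]] [B [hB QB]]; split; last first.
  exists (fun l => A l \/ B l); split; first exact: (Pi0_and_or _ _ _ hA hB).2.
  move=> l sl; rewrite PA // QB //; split=> [[][x ?]|[x [?|?]]].
  - by exists x; left.
  - by exists x; right.
  - by left; exists x.
  - by right; exists x.
(* [sub h] applies [h] to the head only; [nfst] and [nsnd] then unpack the common witness. *)
pose sub (h : nat -> nat) i (l : seq nat) := if i is j.+1 then nth 0 l i else h (nth 0 l 0).
have subE h x l : size l = k -> mkseq ((sub h)^~ (x :: l)) k.+1 = h x :: l.
  move=> sl; rewrite /mkseq /= -[1]/(1 + 0) iotaDl -map_comp; congr cons.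
  by rewrite -[RHS](mkseq_nth 0) sl.
have hsub h : (forall j, computable_fun j (fun l => h (nth 0 l 0))) ->
    forall i, i < k.+1 -> computable_fun k.+1 (sub h i).
  by move=> hh [|i] _; [exact: hh | exact: computable_nth].
have hfst := hsub nfst (fun j => computable_nfst _ _ (computable_nth j 0)).
have hsnd := hsub nsnd (fun j => computable_nsnd _ _ (computable_nth j 0)).
have h := Pi0_and_or _ _ _ ((hierarchy_subst p _ _ A _ hfst).2 hA)
                           ((hierarchy_subst p _ _ B _ hsnd).2 hB).
exists (fun l => A (mkseq ((sub nfst)^~ l) k.+1) /\ B (mkseq ((sub nsnd)^~ l) k.+1)).
split; first exact: h.1.
move=> l sl; rewrite PA // QB //; split=> [[[x hx] [y hy]]|[z]].
  by exists (npair x y); rewrite !subE // nfst_npair nsnd_npair.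
by rewrite !subE // => -[? ?]; split; [exists (nfst z) | exists (nsnd z)].
Qed.

(** * Pointclasses and universal predicates *)

Record pointclass (G : nat -> (seq nat -> Prop) -> Prop) : Prop := {
  pc_ext : forall {k P Q}, (forall l, size l = k -> (P l <-> Q l)) -> G k P -> G k Q;
  pc_computable : forall {k P}, computable_pred k P -> G k P;
  pc_and : forall {k P Q}, G k P -> G k Q -> G k (fun l => P l /\ Q l);
  pc_or : forall {k P Q}, G k P -> G k Q -> G k (fun l => P l \/ Q l);
  pc_subst : forall {k m P} {gs : nat -> seq nat -> nat},
    (forall i, i < k -> computable_fun m (gs i)) -> G k P ->
    G m (fun l => P (mkseq (gs^~ l) k));
  pc_universal : forall k, exists U, G k.+1 U /\
    forall P, G k P -> exists e, forall l, size l = k -> (P l <-> U (rcons l e)) }.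

(** The witness pairs a value of the quantified variable with a number of machine steps; the matrix
    checks that the machine has then halted with output 0. *)
Lemma Sigma01_universal k : exists U, Sigma0 1 k.+1 U /\
  forall P, Sigma0 1 k P -> exists e, forall l, size l = k -> (P l <-> U (rcons l e)).
Proof.
pose arg (l : seq nat) := enc_seq [seq nth 0 l i.+1 | i <- iota 0 k].
pose run l := iter (nsnd (nth 0 l 0)) step
  (ev (nth 0 l k.+1) (npair (nfst (nth 0 l 0)) (arg l)) 0).
have hrun : computable_fun k.+2 run.
  apply: computable_iter; [exact/computable_step/computable_nth | by computability |].
  rewrite /ev; computability.
  by apply: computable_enc_seq => i _; apply: computable_nth.
exists (fun l => exists z, run (z :: l) = ret 0 0); split.
  exists (fun l => run l = ret 0 0); split=> //.
  by apply: computable_pred_eq => //; apply: computable_const.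
move=> P [Q [[c hc] PQ]]; exists (enc c) => l sl.
have runE z : run (z :: rcons l (enc c)) =
    iter (nsnd z) step (ev (enc c) (enc_seq (nfst z :: l)) 0).
  have argE : arg (z :: rcons l (enc c)) = enc_seq l.
    rewrite /arg -[in RHS](mkseq_nth 0 l) sl; congr enc_seq.
    by apply/eq_in_map => i; rewrite mem_iota /= nth_rcons sl => ->.
  have lastE : nth 0 (z :: rcons l (enc c)) k.+1 = enc c.
    by rewrite /= nth_rcons sl ltnn eqxx.
  by rewrite /run argE lastE.
rewrite PQ //; split=> [[x Qx]|[z hz]].
  have [|y [hy Qy]] := hc (x :: l); first by rewrite /= sl.
  have [m hm] := eval_reaches hy 0.
  by exists (npair x m); rewrite runE nfst_npair nsnd_npair hm Qy.1.
(* The code is total on such inputs, so a value exists, and uniqueness of the halting state forces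
   it to be 0. *)
exists (nfst z); have [|y [hy ->]] := hc (nfst z :: l); first by rewrite /= sl.
apply: reaches_ret_unique (eval_reaches hy 0) _.
by exists (nsnd z); rewrite -runE.
Qed.

(** One level up, an existential quantifier is put before the complement of a universal predicate.
    The index comes last, so prefixing a variable leaves it in place. *)
Lemma Sigma0_universal p : forall k, exists U, Sigma0 p.+1 k.+1 U /\
  forall P, Sigma0 p.+1 k P -> exists e, forall l, size l = k -> (P l <-> U (rcons l e)).
Proof.
elim: p => [|p IH] k; first exact: Sigma01_universal.
have [U [hU univU]] := IH k.+1.
exists (fun l => exists x, ~ U (x :: l)); split.
  by exists (fun l => ~ U l); split=> //; exact: (hierarchy_not p.+1 _ U).1.
move=> P [Q [hQ PQ]]; have [e he] := univU _ ((hierarchy_not p.+1 _ Q).2 hQ).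
exists e => l sl; rewrite PQ //.
have {}he x : Q (x :: l) <-> ~ U (x :: rcons l e).
  by have := he (x :: l); rewrite /= sl => /(_ erefl); tauto.
by split=> -[x /he]; exists x.
Qed.

Lemma pointclass_Sigma0 p : pointclass (Sigma0 p.+1).
Proof.
split.
- by move=> k P Q; apply: Sigma0_ext.
- by move=> k P /(hierarchy_computable p.+1)[].
- by move=> k P Q hP hQ; have [] := Sigma0_and_or p.+1 _ _ _ hP hQ.
- by move=> k P Q hP hQ; have [] := Sigma0_and_or p.+1 _ _ _ hP hQ.
- by move=> k m P gs /(hierarchy_subst p.+1 _ _ P)[].
- exact: Sigma0_universal.
Qed.

Lemma pointclass_Pi0 p : pointclass (Pi0 p.+1).
Proof.
split.
- by move=> k P Q; apply: Pi0_ext.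
- by move=> k P /(hierarchy_computable p.+1)[].
- move=> k P Q /Pi0P hP /Pi0P hQ; apply/Pi0P.
  by apply: Sigma0_ext (Sigma0_and_or p.+1 _ _ _ hP hQ).2 => l _; tauto.
- move=> k P Q /Pi0P hP /Pi0P hQ; apply/Pi0P.
  by apply: Sigma0_ext (Sigma0_and_or p.+1 _ _ _ hP hQ).1 => l _; tauto.
- by move=> k m P gs /(hierarchy_subst p.+1 _ _ P)[].
- move=> k; have [U [hU univU]] := Sigma0_universal p k.
  exists (fun l => ~ U l); split; first exact: (hierarchy_not p.+1 _ U).1.
  move=> P /Pi0P/univU[e he]; exists e => l sl; have := he l sl; tauto.
Qed.

(** * Finite quantifiers and equivalence closures *)

Lemma pc_forall {G} (hG : pointclass G) {I : finType} {k} {P : I -> seq nat -> Prop} :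
  (forall i, G k (P i)) -> G k (fun l => forall i, P i l).
Proof.
move=> hP.
have hs (s : seq I) : G k (fun l => forall i, i \in s -> P i l).
  elim: s => [|i s IH].
    by apply: (pc_ext _ hG _ (pc_computable _ hG (computable_pred_const k true))).
  apply: (pc_ext _ hG _ (pc_and _ hG (hP i) IH)) => l _; split=> [[Pi Ps] j|h].
    by rewrite inE => /predU1P[->|/Ps].
  by split=> [|j js]; apply: h; rewrite inE ?eqxx ?js ?orbT.
by apply: (pc_ext _ hG _ (hs (enum I))) => l _; split=> h i // ; apply: h; rewrite mem_enum.
Qed.

Lemma pc_exists {G} (hG : pointclass G) {I : finType} {k} {P : I -> seq nat -> Prop} :
  (forall i, G k (P i)) -> G k (fun l => exists i, P i l).
Proof.
move=> hP.
have hs (s : seq I) : G k (fun l => exists2 i, i \in s & P i l).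
  elim: s => [|i s IH].
    apply: (pc_ext _ hG _ (pc_computable _ hG (computable_pred_const k false))) => l _.
    by split=> // -[].
  apply: (pc_ext _ hG _ (pc_or _ hG (hP i) IH)) => l _; split=> [[Pi|[j js Pj]]|[j]].
  - by exists i; rewrite ?mem_head.
  - by exists j; rewrite // inE js orbT.
  - by rewrite inE => /predU1P[->|js Pj]; [left | right; exists j].
apply: (pc_ext _ hG _ (hs (enum I))) => l _; split=> [[i _ Pi]|[i Pi]]; exists i => //.
by rewrite mem_enum.
Qed.

Lemma pc_if {G} (hG : pointclass G) {k} (b : bool) {P : seq nat -> Prop} :
  G k P -> G k (fun l => b -> P l).
Proof.
case: b => hP; first by apply: (pc_ext _ hG _ hP) => l _; split=> // h; exact: h.
by apply: (pc_ext _ hG _ (pc_computable _ hG (computable_pred_const k true))).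
Qed.

(* The equivalence closure of [R]: [i] and [j] are equivalent iff every cut
   separating them is crossed by an edge. This form is positive in [R] and uses
   only finite quantifiers, so it stays in any pointclass containing [R]. *)
Definition cut_connected {n} (R : 'I_n -> 'I_n -> Prop) (i j : 'I_n) : Prop :=
  forall S : {set 'I_n}, (i \in S) && (j \notin S) ->
  exists a, exists b, ((a \in S) && (b \notin S)) /\ (R a b \/ R b a).

Lemma cut_connected_sym {n} (R : 'I_n -> 'I_n -> Prop) i j :
  cut_connected R i j -> cut_connected R j i.
Proof.
move=> h S hS; have [|a [b [hab Rab]]] := h (~: S); first by rewrite !inE negbK andbC.
by exists b, a; move: hab; rewrite !inE negbK andbC; tauto.
Qed.

(** A cut separating [i] from [k] separates [j] from one of them. *)
Lemma cut_connected_trans {n} (R : 'I_n -> 'I_n -> Prop) i j k :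
  cut_connected R i j -> cut_connected R j k -> cut_connected R i k.
Proof.
move=> hij hjk S /andP[iS kS]; case jS: (j \in S).
  by apply: hjk; rewrite jS.
by apply: hij; rewrite iS jS.
Qed.

(** No edge leaves the class of [i]; if [j] were outside, this class would be a cut crossed by no
    edge. *)
Lemma cut_connectedE {n} (R : 'I_n -> 'I_n -> Prop) :
  (forall i, R i i) -> (forall i j, R i j -> R j i) ->
  (forall i j k, R i j -> R j k -> R i k) ->
  forall i j, cut_connected R i j <-> R i j.
Proof.
move=> Rr Rs Rt i j; split=> [h|Rij S hS]; last by exists i, j; split=> //; left.
pose S : {set 'I_n} := [set k | if excluded_middle_informative (R i k) then true else false].
have SP k : reflect (R i k) (k \in S).
  by rewrite inE; case: excluded_middle_informative => Rik; constructor.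
apply: NNPP => nRij; have [|a [b [/andP[/SP Ria /SP nRib] Rab]]] := h S.
  by apply/andP; split; apply/SP.
by apply: nRib; apply: Rt Ria _; case: Rab => // /Rs.
Qed.

(** * Block relations and diagonalisation *)

Lemma pigeonhole_ord n (f : 'I_n.+1 -> nat) :
  (forall i, f i < n) -> exists i j : 'I_n.+1, i < j /\ f i = f j.
Proof.
move=> hf; pose g i := Ordinal (hf i).
have /injectivePn[i [j ij eij]] : ~~ injectiveb g.
  by apply/injectiveP => /leq_card; rewrite !card_ord ltnn.
have {}eij : f i = f j by move: eij => /(congr1 val).
case: (ltngtP i j) => [?|?|/val_inj eq_ij]; first by exists i, j.
  by exists j, i.
by rewrite eq_ij eqxx in ij.
Qed.

(* The element <<e, x>, i> stands for the i-th entry of the n-tuple x, compared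
   using the e-th relation enumerated by [U]. *)
Definition block_edge (n : nat) (U : seq nat -> Prop) (b : nat) (i j : 'I_n) : Prop :=
  U [:: enc_nth (nsnd b) i; enc_nth (nsnd b) j; nfst b].

(** An arbitrary index need not give an equivalence relation; the closure forces one and changes
    nothing if it does. Numbers outside all blocks are alone in their classes. *)
Definition block_rel (n : nat) (U : seq nat -> Prop) (u v : nat) : Prop :=
  u = v \/ exists i j : 'I_n, (u = npair (nfst u) i /\ v = npair (nfst u) j) /\
    cut_connected (block_edge n U (nfst u)) i j.

Lemma block_rel_eqrel n U : eqrel_omega (block_rel n U).
Proof.
split; first by left.
split=> [u v [->|[i [j [[eu ev] h]]]]|u v w [->//|[i [j [[eu ev] h]]]] [<-|]].
- by left.
- have ef : nfst v = nfst u by rewrite ev nfst_npair.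
  by right; exists j, i; rewrite ef; split=> //; apply: cut_connected_sym.
- by right; exists i, j.
- move=> [j' [k [[ev' ew] h']]]; right; exists i, k.
  have ef : nfst v = nfst u by rewrite ev nfst_npair.
  rewrite ef in ev' ew h'; split=> //; apply: cut_connected_trans h _.
  by move: ev'; rewrite ev => /npair_inj[_ /val_inj ->].
Qed.

Lemma block_rel_pointclass G n U : pointclass G -> G 3 U ->
  G 2 (rel_pred (block_rel n U)).
Proof.
move=> hG hU; have hu := computable_nth 2 0; have hv := computable_nth 2 1.
have hb := computable_nfst _ _ hu.
have hpair (i : 'I_n) := computable_npair _ _ _ hb (computable_const 2 i).
have hedge (i j : 'I_n) : G 2 (fun l => block_edge n U (nfst (nth 0 l 0)) i j).
  pose gs m l := nth 0 [:: enc_nth (nsnd (nfst (nth 0 l 0))) i;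
    enc_nth (nsnd (nfst (nth 0 l 0))) j; nfst (nfst (nth 0 l 0))] m.
  apply: (pc_subst _ hG (gs := gs) _ hU).
  by move=> [|[|[|]]] //= _; rewrite /gs /=; computability.
apply: (pc_or _ hG); first exact/(pc_computable _ hG)/computable_pred_eq.
apply: (pc_exists hG) => i; apply: (pc_exists hG) => j; apply: (pc_and _ hG).
  by apply: (pc_and _ hG); apply/(pc_computable _ hG)/computable_pred_eq.
apply: (pc_forall hG) => S; apply: (pc_if hG).
apply: (pc_exists hG) => a; apply: (pc_exists hG) => b; apply: (pc_and _ hG).
  exact/(pc_computable _ hG)/computable_pred_const.
by apply: (pc_or _ hG).
Qed.

(** If [e] is an index of [F], the i-th entry of [x] goes to position [i] of the block of [e] and
    [x], whose edges already form an equivalence relation. *)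
Lemma block_rel_complete (G : nat -> (seq nat -> Prop) -> Prop) n U :
  (forall P, G 2 P -> exists e, forall l, size l = 2 -> (P l <-> U (rcons l e))) ->
  forall F, eqrel_omega F -> G 2 (rel_pred F) -> nary_reducible n F (block_rel n U).
Proof.
move=> univU F [Fr [Fs Ft]] /univU[e he].
pose b (x : n.-tuple nat) := npair e (enc_seq x).
exists (fun x => [tuple npair (b x) i | i < n]); split=> [i|x i j lt_ij].
  have [c hc] : computable_fun n (fun l =>
      npair (npair e (enc_seq [seq nth 0 l j | j <- iota 0 n])) i).
    computability; apply: computable_enc_seq => j _; exact: computable_nth.
  exists c => x; have := hc x (size_tuple x).
  have -> : [seq nth 0 x j | j <- iota 0 n] = x.
    by rewrite -[RHS](mkseq_nth 0 x) size_tuple.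
  by rewrite tnth_mktuple.
have edgeE a d : block_edge n U (b x) a d <-> F (tnth x a) (tnth x d).
  rewrite /block_edge /b nsnd_npair nfst_npair !enc_nthE !(tnth_nth 0).
  by have := he [:: nth 0 x a; nth 0 x d] erefl => <-.
rewrite !tnth_mktuple -edgeE -(cut_connectedE (block_edge n U (b x))); first last.
- by move=> i1 i2 i3; rewrite !edgeE; apply: Ft.
- by move=> i1 i2; rewrite !edgeE; apply: Fs.
- by move=> i1; rewrite edgeE.
split=> [h|[/npair_inj[_ /val_inj ij]|]].
- by right; exists i, j; rewrite nfst_npair.
- by rewrite ij ltnn in lt_ij.
- move=> [i' [j' []]]; rewrite nfst_npair.
  by move=> [/npair_inj[_ /val_inj <-] /npair_inj[_ /val_inj <-]].
Qed.

(** Distinct related elements share a block, which has only [n] positions for [n.+1] elements. *)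
Lemma block_rel_tuple n U (y : 'I_n.+1 -> nat) : 0 < n ->
  (forall i j : 'I_n.+1, i < j -> block_rel n U (y i) (y j)) ->
  exists i j : 'I_n.+1, i < j /\ y i = y j.
Proof.
move=> n0 hy; apply: NNPP => inj_y.
have hpair (i j : 'I_n.+1) : i < j -> exists i' j' : 'I_n,
    y i = npair (nfst (y i)) i' /\ y j = npair (nfst (y i)) j'.
  move=> ij; case: (hy i j ij) => [eij|[i' [j' [h _]]]]; last by exists i', j'.
  by case: inj_y; exists i, j.
(* Positive indices are compared with index 0, and index 0 with the last one, which differs from it
   as [n] is positive. *)
have hsnd i : nsnd (y i) < n.
  case: (posnP i) => [i0|i0].
    have [|i' [j' [-> _]]] := hpair i ord_max; first by rewrite i0.
    by rewrite nsnd_npair.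
  by have [i' [j' [_ ->]]] := hpair ord0 i i0; rewrite nsnd_npair.
have [i [j [ij eij]]] := pigeonhole_ord n _ hsnd.
case: inj_y; exists i, j; split=> //.
have [i' [j' [hi hj]]] := hpair i j ij.
by move: eij; rewrite hj [in X in X = _]hi !nsnd_npair hi nfst_npair => ->.
Qed.

(* Blocks {z | nfst z = e} are collapsed iff the e-th predicate holds of
   (<e, 0>, ..., <e, n>). *)
Definition diag_rel (n : nat) (U : seq nat -> Prop) (u v : nat) : Prop :=
  u = v \/ (nfst u = nfst v /\ U (rcons (mkseq (npair (nfst u)) n.+1) (nfst u))).

Lemma diag_rel_eqrel n U : eqrel_omega (diag_rel n U).
Proof.
split; first by left.
split=> [u v [->|[e h]]|u v w [->//|[e h]] [<-|[e' h']]]; first by left.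
- by right; rewrite -e.
- by right.
- by right; rewrite e.
Qed.

Lemma diag_rel_pointclass G n U : pointclass G -> G n.+2 U ->
  G 2 (rel_pred (diag_rel n U)).
Proof.
move=> hG hU; have hu := computable_nth 2 0; have hv := computable_nth 2 1.
apply: (pc_or _ hG); first exact/(pc_computable _ hG)/computable_pred_eq.
apply: (pc_and _ hG).
  by apply/(pc_computable _ hG)/computable_pred_eq; apply: computable_nfst.
(* The chosen block elements fill the first [n.+1] arguments; the block number, serving as index,
   comes last. *)
pose gs m (l : seq nat) :=
  if m < n.+1 then npair (nfst (nth 0 l 0)) m else nfst (nth 0 l 0).
have hgs m : m < n.+2 -> computable_fun 2 (gs m).
  by move=> _; rewrite /gs; case: (m < n.+1); computability.
apply: (pc_ext _ hG _ (pc_subst _ hG hgs hU)) => l _.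
suff -> : mkseq (gs^~ l) n.+2 =
  rcons (mkseq (npair (nfst (nth 0 l 0))) n.+1) (nfst (nth 0 l 0)) by [].
rewrite mkseqS {2}/gs ltnn; congr rcons; apply/eq_in_map => m.
by rewrite mem_iota /gs /= => ->.
Qed.

(* Diagonalisation against the predicate "the images are pairwise distinct". *)
Lemma diag_rel_irreducible G n U V : pointclass G -> 0 < n ->
  (forall P, G n.+1 P ->
    exists e, forall l, size l = n.+1 -> (P l <-> U (rcons l e))) ->
  ~ nary_reducible n.+1 (diag_rel n U) (block_rel n V).
Proof.
move=> hG n0 univU [H [hH red]].
pose y (i : 'I_n.+1) (l : seq nat) := tnth (H (insubd [tuple of nseq n.+1 0] l)) i.
have hy i : computable_fun n.+1 (y i).
  have [c hc] := hH i; exists c => l /eqP sl.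
  by have := hc (Tuple sl); rewrite /y -{2}(valKd [tuple of nseq n.+1 0] (Tuple sl)).
(* Decidable from the reduction, [P] lies in every pointclass despite the negation. *)
pose P l := forall i j : 'I_n.+1, i < j -> ~ y i l = y j l.
have hP : G n.+1 P.
  apply: (pc_forall hG) => i; apply: (pc_forall hG) => j; apply: (pc_if hG).
  exact/(pc_computable _ hG)/computable_pred_not/computable_pred_eq.
have [e he] := univU _ hP.
have sx : size (mkseq (npair e) n.+1) == n.+1 by rewrite size_mkseq.
pose x := Tuple sx.
have yx i : y i x = tnth (H x) i by rewrite /y valKd.
have xE i : tnth x i = npair e i by rewrite (tnth_nth 0) nth_mkseq.
have diagE (i j : 'I_n.+1) : i < j -> diag_rel n U (tnth x i) (tnth x j) <-> P x.
  move=> ij; rewrite he ?size_tuple // !xE /diag_rel !nfst_npair; split; last by right.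
  by case=> [/npair_inj[_ e_ij]|[]//]; rewrite e_ij ltnn in ij.
(* If [P x] holds, block [e] collapses and all images are related, so two of them coincide, against
   [P x]. *)
case: (classic (P x)) => [Px|nPx].
  have [|i [j [ij eij]]] := block_rel_tuple n V (tnth (H x)) n0.
    by move=> i j ij; apply/red => //; apply/diagE.
  by apply: (Px i j ij); rewrite !yx.
(* Otherwise two images coincide, so the reduction relates two distinct elements of block [e], which
   yields [P x]. *)
apply: nPx => i j ij; rewrite !yx => eij.
have /diagE h : diag_rel n U (tnth x i) (tnth x j) by apply/red => //; left.
by apply: (h ij i j ij); rewrite !yx.
Qed.

Lemma pointclass_strict G n : pointclass G -> 0 < n ->
  exists E, eqrel_omega E /\ G 2 (rel_pred E) /\
    (forall F, eqrel_omega F -> G 2 (rel_pred F) -> nary_reducible n F E) /\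
    ~ (forall F, eqrel_omega F -> G 2 (rel_pred F) -> nary_reducible n.+1 F E).
Proof.
move=> hG n0; have [V [hV univV]] := pc_universal _ hG 2.
have [U [hU univU]] := pc_universal _ hG n.+1.
exists (block_rel n V); split; first exact: block_rel_eqrel.
split; first exact: block_rel_pointclass.
split; first exact: block_rel_complete.
move=> /(_ _ (diag_rel_eqrel n U) (diag_rel_pointclass _ _ _ hG hU)).
exact: diag_rel_irreducible hG n0 univU.
Qed.

(** * The computable case *)

Definition first_sat (f : nat -> nat) (s : seq nat) : nat :=
  foldr (fun j r => ifz (f j) j r) 0 s.

Lemma first_satP f s i : i \in s -> f i = 0 ->
  first_sat f s \in s /\ f (first_sat f s) = 0.
Proof.
elim: s => //= j s IH; rewrite inE; case fj: (f j) => [|m] /=.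
  by rewrite mem_head.
move=> /predU1P[->|js] fi; first by rewrite fi in fj.
by have [h1 h2] := IH js fi; rewrite inE h1 orbT.
Qed.

(** This gives related entries of a tuple the same representative, as they are related to the same
    entries. *)
Lemma eq_first_sat f g s : (forall j, j \in s -> (f j = 0 <-> g j = 0)) ->
  first_sat f s = first_sat g s.
Proof.
elim: s => //= j s IH fg; rewrite IH => [|i si]; last by apply: fg; rewrite inE si orbT.
by have := fg j (mem_head j s); case: (f j) (g j) => [|?] [|?] [] // => [/(_ erefl)|_ /(_ erefl)].
Qed.

Lemma computable_first_sat k (f : nat -> seq nat -> nat) s :
  (forall j, j \in s -> computable_fun k (f j)) ->
  computable_fun k (fun l => first_sat (f^~ l) s).
Proof.
elim: s => [|j s IH] hf; first exact: computable_const.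
apply: computable_ifz; [exact/hf/mem_head | exact: computable_const |].
by apply: IH => i si; apply: hf; rewrite inE si orbT.
Qed.

Lemma computable_strict n : 0 < n ->
  exists E, eqrel_omega E /\ computable_pred 2 (rel_pred E) /\
    (forall F, eqrel_omega F -> computable_pred 2 (rel_pred F) -> nary_reducible n F E) /\
    ~ (forall F, eqrel_omega F -> computable_pred 2 (rel_pred F) ->
       nary_reducible n.+1 F E).
Proof.
(* Truncation at [n.-1] leaves [n] classes: the singletons below [n.-1] and one class of all other
   numbers. *)
move=> n0; exists (fun x y => minn x n.-1 = minn y n.-1).
split; first by split=> // ; split=> [x y ->|x y z -> ->].
split.
  have hmin i : computable_fun 2 (fun l => minn (nth 0 l i) n.-1).
    apply: (@computable_fun_ext _ (fun l => nth 0 l i - (nth 0 l i - n.-1))).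
      by move=> l _; rewrite minnE.
    by do 2?apply: computable_sub; computability.
  exact: computable_pred_eq.
split=> [F [Fr [Fs Ft]] /computable_predP[f [hf Ff]]|].
  (* Each entry goes to the first index of an entry related to it; distinct indices below [n] lie in
     distinct classes. *)
  pose h (i : 'I_n) (l : seq nat) :=
    first_sat (fun j => f [:: nth 0 l j; nth 0 l i]) (iota 0 n).
  exists (fun x => [tuple h i x | i < n]); split=> [i|x i j _].
    have [|c hc] := computable_first_sat n
      (fun j l => f [:: nth 0 l j; nth 0 l i]) (iota 0 n).
      by move=> j _; apply: (@computable_app2 (fun a b => f [:: a; b]) n);
        [apply: computable_fun_ext hf => -[|? [|? []]] | exact: computable_nth..].
    by exists c => x; rewrite tnth_mktuple; apply: hc; rewrite size_tuple.
  have fF a b : f [:: a; b] = 0 <-> F a b by rewrite -Ff.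
  have hP k : h k x < n /\ F (nth 0 x (h k x)) (tnth x k).
    have [||] := first_satP (fun j => f [:: nth 0 x j; nth 0 x k]) (iota 0 n) k.
    - by rewrite mem_iota /=.
    - exact/fF/Fr.
    - by rewrite -/(h k x) mem_iota /= (tnth_nth 0) => -> /fF.
  rewrite !tnth_mktuple; have [lti Fi] := hP i; have [ltj Fj] := hP j.
  have minE a : a < n -> minn a n.-1 = a by lia.
  rewrite !minE //; split=> [Fij|e_ij].
    apply: eq_first_sat => k _; rewrite !fF -!(tnth_nth 0).
    by split=> Fk; apply: Ft Fk _ => //; apply: Fs.
  by apply: Ft (Fs _ _ Fi) _; rewrite e_ij.
move=> /(_ eq) [] //.
- by split=> //; split=> [x y ->|x y z -> ->].
- by apply: computable_pred_eq; apply: computable_nth.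
move=> H [_ red].
(* The entries 0 to [n] are distinct, but their images meet at most [n] classes. *)
pose x := [tuple val i | i < n.+1].
have [i|i [j [ij eij]]] := pigeonhole_ord n (fun i => minn (tnth (H x) i) n.-1).
  by rewrite gtn_min prednK // leqnn orbT.
by have /red -/(_ x) := ij; rewrite !tnth_mktuple eij => -[_ /(_ erefl) e_ij];
  rewrite e_ij ltnn in ij.
Qed.

Theorem theorem4p11 (p n : nat) (hn : 2 <= n) :
  (exists E : nat -> nat -> Prop,
      eqrel_omega E /\ Sigma0_rel p E /\
      (forall F, eqrel_omega F -> Sigma0_rel p F -> nary_reducible n F E) /\
      ~ (forall F, eqrel_omega F -> Sigma0_rel p F -> nary_reducible n.+1 F E)) /\
  (exists E : nat -> nat -> Prop,
      eqrel_omega E /\ Pi0_rel p E /\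
      (forall F, eqrel_omega F -> Pi0_rel p F -> nary_reducible n F E) /\
      ~ (forall F, eqrel_omega F -> Pi0_rel p F -> nary_reducible n.+1 F E)).
Proof.
have n0 : 0 < n by apply: leq_trans hn.
(* At level 0 both classes consist of the computable relations, so one result serves twice. *)
case: p => [|p]; first by split; apply: computable_strict.
split; first exact: pointclass_strict (pointclass_Sigma0 p) n0.
exact: pointclass_strict (pointclass_Pi0 p) n0.
Qed.
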